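(* Let $\varepsilon>0$ and $\delta>0$. Suppose $S\subseteq\Omega$ is such that every $(x,y)\in S^2$ is $\varepsilon$ distance-decreasing. Let $$\pi(S) > 1-\frac{\varepsilon\delta}{6\,\operatorname{diam}(\Omega)}\quad\text{and}\quad T\ge\frac{\ln(2\,\operatorname{diam}(\Omega)/\delta)}{\varepsilon}.$$ Then if $X_0$ is a warm start to $\pi$, $$\|X_T-\pi\|_{\mathrm{TV}}<\delta,$$ where $X_T$ is the state of the Markov chain after $T$ steps started from the random state $X_0$.
   Context: $\Omega$ is a finite state space carrying a Markov chain with a unique stationary distribution $\pi$. $\rho$ is an arbitrary integer-valued metric on $\Omega$, and $\operatorname{diam}(\Omega)=\max_{x,y\in\Omega}\rho(x,y)$. A (one-step) coupling specifies, for every pair of states $(X_t,Y_t)\in\Omega^2$, a distribution for $(X_{t+1},Y_{t+1})$ such that $X_t\to X_{t+1}$, and similarly $Y_t\to Y_{t+1}$, behave according to the Markov chain. For $\varepsilon>0$, a pair $(x,y)\in\Omega^2$ is $\varepsilon$ distance-decreasing if there exists a coupling such that $\mathbf{E}(\rho(X_1,Y_1)\mid X_0=x,Y_0=y)\le(1-\varepsilon)\rho(x,y)$. A random state $X_0$ (or its distribution) is a warm start to $\pi$ if $\mathbf{Pr}(X_0=z)\le2\pi(z)$ for all $z\in\Omega$. For distributions $\mu,\nu$ on $\Omega$, $\|\mu-\nu\|_{\mathrm{TV}}=\frac12\sum_{x\in\Omega}|\mu(x)-\nu(x)|$; $\|X-\nu\|_{\mathrm{TV}}$ for a random variable $X$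 means the variation distance between the distribution of $X$ and $\nu$.
   Formalization: The formal theorem also assumes ε ≤ 1 (automatic once S has two distinct points; the claim can fail for larger ε when S has at most one point), and it is vacuous when diam(Ω) = 0, where the stated bounds are undefined. *)

(* Defs.v *)
From mathcomp Require Import all_boot all_order all_algebra.
From mathcomp Require Import reals exp.
Set Implicit Arguments.
Unset Strict Implicit.
Unset Printing Implicit Defensive.
Import Order.TTheory GRing.Theory Num.Theory.
Local Open Scope ring_scope.

Definition is_distribution (R : realType) (A : finType) (mu : A -> R) : Prop :=
  (forall a, 0 <= mu a) /\ \sum_a mu a = 1.

Definition prob (R : realType) (A : finType) (mu : A -> R) (S : {set A}) : R :=
  \sum_(a in S) mu a.

Definition tv_dist (R : realType) (A : finType) (mu nu : A -> R) : R :=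
  2^-1 * \sum_a `|mu a - nu a|.

(* A Markov chain is given by its transition probabilities:
   P x y = Pr(X_{t+1} = y | X_t = x). *)
Definition is_markov_chain (R : realType) (Omega : finType)
    (P : Omega -> Omega -> R) : Prop :=
  forall x, is_distribution (P x).

Definition step (R : realType) (Omega : finType) (P : Omega -> Omega -> R)
    (mu : Omega -> R) : Omega -> R :=
  fun y => \sum_x mu x * P x y.

(* The distribution of X_t when X_0 has distribution mu. *)
Definition law_at (R : realType) (Omega : finType) (P : Omega -> Omega -> R)
    (mu : Omega -> R) (t : nat) : Omega -> R :=
  iter t (step P) mu.

Definition is_stationary (R : realType) (Omega : finType)
    (P : Omega -> Omega -> R) (mu : Omega -> R) : Prop :=
  is_distribution mu /\ step P mu =1 mu.

Definition is_unique_stationary (R : realType) (Omega : finType)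
    (P : Omega -> Omega -> R) (mu : Omega -> R) : Prop :=
  is_stationary P mu /\ (forall nu, is_stationary P nu -> nu =1 mu).

Record is_int_metric (Omega : finType) (rho : Omega -> Omega -> int) : Prop := {
  int_metric_ge0 : forall x y, 0 <= rho x y;
  int_metric_eq0 : forall x y, rho x y = 0 <-> x = y;
  int_metric_sym : forall x y, rho x y = rho y x;
  int_metric_triangle : forall x y z, rho x z <= rho x y + rho y z
}.

(* The default value 0 of the iterated maximum is harmless: rho is
   nonnegative. *)
Definition diam (Omega : finType) (rho : Omega -> Omega -> int) : int :=
  \big[Order.max/0]_(p : Omega * Omega) rho p.1 p.2.

(* C x y is the joint distribution of (X_{t+1}, Y_{t+1}) given
   (X_t, Y_t) = (x, y). *)
Record is_coupling (R : realType) (Omega : finType) (P : Omega -> Omega -> R)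
    (C : Omega -> Omega -> Omega * Omega -> R) : Prop := {
  coupling_distribution : forall x y, is_distribution (C x y);
  coupling_left : forall x y x', \sum_y' C x y (x', y') = P x x';
  coupling_right : forall x y y', \sum_x' C x y (x', y') = P y y'
}.

Definition distance_decreasing (R : realType) (Omega : finType)
    (P : Omega -> Omega -> R) (rho : Omega -> Omega -> int) (eps : R)
    (x y : Omega) : Prop :=
  exists C : Omega -> Omega -> Omega * Omega -> R,
    is_coupling P C /\
    \sum_z C x y z * (rho z.1 z.2)%:~R <= (1 - eps) * (rho x y)%:~R.

Definition warm_start (R : realType) (Omega : finType) (pi mu : Omega -> R) :
    Prop :=
  is_distribution mu /\ (forall z, mu z <= 2 * pi z).

(* Main.v *)
Require Import Defs.
From mathcomp Require Import all_boot all_order all_algebra.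
From mathcomp Require Import boolp reals sequences exp.
From mathcomp Require Import ring lra.
Import Order.TTheory GRing.Theory Num.Theory.
Local Open Scope ring_scope.

Set Implicit Arguments.
Unset Strict Implicit.

(** Run the chain from the warm start and from [pi] side by side, moving pairs
    in [S^2] by the contracting couplings and all other pairs independently.
    The mean distance satisfies
    [D_(t+1) <= (1 - eps) D_t + diam * Pr(X_t or Y_t outside S)].
    Warmness is preserved in time, so this probability is at most
    [3 (1 - pi S)], and solving the recursion gives
    [D_T <= exp (- eps T) diam + 3 diam (1 - pi S) / eps < delta].
    As distinct points are at distance at least 1, [D_T] dominates the
    variation distance. *)

(** * Couplings of two fixed distributions *)

Record is_joint (R : realType) (A : finType) (mu nu : A -> R)
    (J : A * A -> R) : Prop := {
  joint_ge0 : forall z, 0 <= J z;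
  joint_left : forall a, \sum_b J (a, b) = mu a;
  joint_right : forall b, \sum_a J (a, b) = nu b
}.

Lemma sum_joint_left (R : realType) (A : finType) (mu nu : A -> R) J
    (f : A -> R) :
  is_joint mu nu J -> \sum_z J z * f z.1 = \sum_a mu a * f a.
Proof.
move=> [_ hl _]; transitivity (\sum_a \sum_b J (a, b) * f a).
  by rewrite pair_bigA; apply: eq_bigr => -[].
by apply: eq_bigr => a _; rewrite -mulr_suml hl.
Qed.

Lemma sum_joint_right (R : realType) (A : finType) (mu nu : A -> R) J
    (f : A -> R) :
  is_joint mu nu J -> \sum_z J z * f z.2 = \sum_b nu b * f b.
Proof.
move=> [_ _ hr]; transitivity (\sum_b \sum_a J (a, b) * f b).
  by rewrite exchange_big pair_bigA; apply: eq_bigr => -[].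
by apply: eq_bigr => b _; rewrite -mulr_suml hr.
Qed.

Lemma sum_joint (R : realType) (A : finType) (mu nu : A -> R) J :
  is_joint mu nu J -> \sum_z J z = \sum_a mu a.
Proof.
move=> hJ; have := sum_joint_left (fun=> 1) hJ.
by under eq_bigr do rewrite mulr1; under [RHS]eq_bigr do rewrite mulr1.
Qed.

Lemma joint_independent (R : realType) (A : finType) (mu nu : A -> R) :
  is_distribution mu -> is_distribution nu ->
  is_joint mu nu (fun z => mu z.1 * nu z.2).
Proof.
move=> [mu0 mu1] [nu0 nu1]; split=> [z|a|b] /=; first exact: mulr_ge0.
- by rewrite -mulr_sumr nu1 mulr1.
- by rewrite -mulr_suml mu1 mul1r.
Qed.

(** The kernel [K] may depend on both coordinates of the pair, but each marginal of [K w] sees only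
    one of them. Summing out the other new coordinate first therefore leaves a sum against one
    marginal of [J]. *)
Lemma joint_step (R : realType) (A : finType) (P : A -> A -> R)
    (mu nu : A -> R) J (K : A * A -> A * A -> R) :
  is_joint mu nu J ->
  (forall w, is_joint (P w.1) (P w.2) (K w)) ->
  is_joint (step P mu) (step P nu) (fun z => \sum_w J w * K w z).
Proof.
move=> hJ hK; split=> [z|a|b].
- by apply: sumr_ge0 => w _; rewrite mulr_ge0 ?(joint_ge0 hJ)
    ?(joint_ge0 (hK w)).
- rewrite exchange_big /= /step -(sum_joint_left (P^~ a) hJ).
  by apply: eq_bigr => w _; rewrite -mulr_sumr (joint_left (hK w)).
- rewrite exchange_big /= /step -(sum_joint_right (P^~ b) hJ).
  by apply: eq_bigr => w _; rewrite -mulr_sumr (joint_right (hK w)).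
Qed.

(** * Distance bounds and variation distance *)

Lemma rho_le_diam (Omega : finType) (rho : Omega -> Omega -> int) x y :
  rho x y <= diam rho.
Proof. exact: (le_bigmax _ (fun p => rho p.1 p.2) (x, y)). Qed.

Lemma diam_ge0 (Omega : finType) (rho : Omega -> Omega -> int) :
  0 <= diam rho.
Proof. exact: bigmax_ge_id. Qed.

Lemma tv_dist_le_mean (R : realType) (A : finType)
    (rho : A -> A -> int) (mu nu : A -> R) J :
  is_int_metric rho -> is_joint mu nu J ->
  tv_dist mu nu <= \sum_z J z * (rho z.1 z.2)%:~R.
Proof.
move=> hrho hJ; rewrite /tv_dist ler_pdivrMl // mulr_sumr.
(* Writing the difference as a mean under [J] leaves, for each pair, a sum over [a] that vanishes on
   the diagonal and is at most 2 off it. *)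
have marg a : mu a - nu a = \sum_z J z * ((z.1 == a)%:R - (z.2 == a)%:R).
  under eq_bigr do rewrite mulrBr.
  rewrite sumrB (sum_joint_left (fun x => (x == a)%:R) hJ).
  rewrite (sum_joint_right (fun x => (x == a)%:R) hJ).
  by congr (_ - _); rewrite (bigD1 a) //= eqxx mulr1 big1 ?addr0 // => i
    /negPf ->; rewrite mulr0.
have dirac (x : A) : \sum_a (x == a)%:R = 1 :> R.
  by rewrite (bigD1 x) //= eqxx big1 ?addr0 // => i; rewrite eq_sym => /negPf ->.
apply: (@le_trans _ _
  (\sum_a \sum_z J z * `|(z.1 == a)%:R - (z.2 == a)%:R|)).
  apply: ler_sum => a _; rewrite marg; apply: le_trans (ler_norm_sum _ _ _) _.
  by apply: ler_sum => z _; rewrite normrM ger0_norm ?(joint_ge0 hJ).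
rewrite exchange_big /=; apply: ler_sum => -[x y] _ /=.
rewrite -mulr_sumr mulrCA; apply: ler_wpM2l; first exact: joint_ge0 hJ _.
have [<-|xy] := eqVneq x y.
  rewrite big1 => [|a _]; last by rewrite subrr normr0.
  by rewrite mulr_ge0 // ler0z int_metric_ge0.
(* Integrality of the metric enters here. *)
have r1 : (1 : R) <= (rho x y)%:~R.
  rewrite ler1z -gtz0_ge1 lt_neqAle int_metric_ge0 // andbT eq_sym.
  by apply/eqP => /(int_metric_eq0 hrho) /eqP; exact/negP.
apply: (@le_trans _ _ (\sum_a ((x == a)%:R + (y == a)%:R))).
  by apply: ler_sum => a _; apply: le_trans (ler_normB _ _) _; rewrite !normr_nat.
by rewrite big_split /= !dirac; lra.
Qed.

Lemma prob_setC (R : realType) (A : finType) (mu : A -> R) (S : {set A}) :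
  is_distribution mu -> prob mu (~: S) = 1 - prob mu S.
Proof.
move=> [_ <-]; rewrite /prob [in RHS](bigID (mem S)) /= addrC addrK.
by apply: eq_bigl => a; rewrite inE.
Qed.

Lemma prob_indicator (R : realType) (A : finType) (mu : A -> R) (S : {set A}) :
  \sum_a mu a * (a \in S)%:R = prob mu S.
Proof.
rewrite /prob [RHS]big_mkcond; apply: eq_bigr => a _.
by case: (a \in S); rewrite ?mulr1 ?mulr0.
Qed.

(** * One-step contraction and its iteration *)

Section Contraction.

Context (R : realType) (Omega : finType) (P : Omega -> Omega -> R).
Hypothesis hP : is_markov_chain P.
Context (rho : Omega -> Omega -> int) (eps : R) (S : {set Omega}).
Hypothesis hrho : is_int_metric rho.
Hypothesis heps1 : eps <= 1.
Hypothesis hS :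
  forall x y, x \in S -> y \in S -> distance_decreasing P rho eps x y.

Let d : R := (diam rho)%:~R.
Let mean (J : Omega * Omega -> R) := \sum_z J z * (rho z.1 z.2)%:~R.

Lemma local_coupling (w : Omega * Omega) :
  exists k, is_joint (P w.1) (P w.2) k /\
    mean k <= (1 - eps) * (rho w.1 w.2)%:~R
              + d * ((w.1 \in ~: S)%:R + (w.2 \in ~: S)%:R).
Proof.
have d0 : 0 <= d by rewrite ler0z diam_ge0.
have [/andP[w1 w2]|wS] := boolP ((w.1 \in S) && (w.2 \in S)).
  (* [C] depends on the pair [w]; only its value at [w] is used. *)
  have [C [[Cd Cl Cr] CE]] := hS w1 w2.
  exists (C w.1 w.2); split; last by rewrite !inE w1 w2 addr0 mulr0 addr0.
  by split=> //; have [] := Cd w.1 w.2.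
have hk := joint_independent (hP w.1) (hP w.2).
exists (fun z => P w.1 z.1 * P w.2 z.2); split=> //.
have mean_d : mean (fun z => P w.1 z.1 * P w.2 z.2) <= d.
  rewrite -[leRHS]mul1r -(proj2 (hP w.1)) -(sum_joint hk) mulr_suml.
  apply: ler_sum => z _; apply: ler_wpM2l; first exact: joint_ge0 hk z.
  by rewrite ler_int rho_le_diam.
(* The contracted term is nonnegative because [eps <= 1], and at least one indicator equals 1, which
   pays for [d]. *)
apply: le_trans mean_d _; rewrite -[leLHS]add0r; apply: lerD.
  by rewrite mulr_ge0 ?subr_ge0 // ler0z int_metric_ge0.
rewrite -[leLHS]mulr1; apply: ler_wpM2l => //.
by move: wS; rewrite !inE; do 2 case: (_ \in S) => //=; lra.
Qed.

Lemma joint_contract mu nu J : is_joint mu nu J ->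
  exists J', is_joint (step P mu) (step P nu) J' /\
    mean J' <= (1 - eps) * mean J + d * (prob mu (~: S) + prob nu (~: S)).
Proof.
(* Choice gathers the local couplings into one kernel; averaging their bounds over [J] turns the
   indicators into probabilities of the marginals. *)
move=> hJ; have [K hK] := choice local_coupling.
exists (fun z => \sum_w J w * K w z); split.
  by apply: joint_step hJ _ => w; have [] := hK w.
have -> : mean (fun z => \sum_w J w * K w z) = \sum_w J w * mean (K w).
  rewrite /mean; under eq_bigr do rewrite mulr_suml.
  rewrite exchange_big; apply: eq_bigr => w _; rewrite mulr_sumr.
  by apply: eq_bigr => z _; rewrite mulrA.
rewrite -(prob_indicator mu) -(prob_indicator nu).
rewrite -(sum_joint_left (fun a => (a \in ~: S)%:R) hJ).
rewrite -(sum_joint_right (fun a => (a \in ~: S)%:R) hJ).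
rewrite /mean -big_split !mulr_sumr -big_split /=; apply: ler_sum => w _.
rewrite -mulrDr mulrCA [d * _]mulrCA -mulrDr.
by apply: ler_wpM2l; [exact: joint_ge0 hJ w | have [] := hK w].
Qed.

(** [step P] is linear and monotone and fixes [pi], so it preserves pointwise domination by
    [2 * pi]. *)
Lemma warm_start_step pi mu :
  is_stationary P pi -> warm_start pi mu -> warm_start pi (step P mu).
Proof.
move=> [_ st] [[mu0 mu1] hw]; split; first split.
- by move=> a; apply: sumr_ge0 => x _; rewrite mulr_ge0 // (proj1 (hP x)).
- rewrite /step exchange_big /= -[RHS]mu1; apply: eq_bigr => x _.
  by rewrite -mulr_sumr (proj2 (hP x)) mulr1.
- move=> a; rewrite -(st a) /step mulr_sumr; apply: ler_sum => x _.
  by rewrite mulrA ler_wpM2r // (proj1 (hP x)).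
Qed.

Lemma warm_start_law_at pi mu t :
  is_stationary P pi -> warm_start pi mu -> warm_start pi (law_at P mu t).
Proof. by move=> st hw; elim: t => // t; apply: warm_start_step. Qed.

(** The hypothesis on [k] says that the recursion [m -> (1 - eps) * m + 3 * d * prob pi (~: S)] does
    not push [k] above itself, so only the excess over [k] has to decay. *)
Lemma warm_start_mean pi mu t k :
  is_stationary P pi -> warm_start pi mu -> 0 <= k ->
  3 * d * prob pi (~: S) <= eps * k ->
  exists J, is_joint (law_at P mu t) pi J /\
    mean J <= (1 - eps) ^+ t * d + k.
Proof.
move=> st hw k0 hk; elim: t => [|t [J [hJ hJE]]].
  have hJ := joint_independent (proj1 hw) (proj1 st).
  exists (fun z => mu z.1 * pi z.2); split=> //.
  rewrite expr0 mul1r -[leLHS]addr0; apply: lerD => //.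
  rewrite -[leRHS]mul1r -(proj2 (proj1 hw)) -(sum_joint hJ) mulr_suml.
  apply: ler_sum => z _; apply: ler_wpM2l; first exact: joint_ge0 hJ z.
  by rewrite ler_int rho_le_diam.
have [J' [[J0 Jl Jr] J'E]] := joint_contract hJ.
exists J'; split; first by split=> // b; rewrite Jr (proj2 st).
apply: le_trans J'E _.
have hwt : prob (law_at P mu t) (~: S) <= 2 * prob pi (~: S).
  rewrite /prob mulr_sumr; apply: ler_sum => a _.
  exact: (proj2 (warm_start_law_at t st hw)).
have d0 : 0 <= d by rewrite ler0z diam_ge0.
(* The constant 3 is 2 from the warm chain plus 1 from the stationary one. *)
have /(ler_wpM2l d0) : prob (law_at P mu t) (~: S) + prob pi (~: S)
  <= 3 * prob pi (~: S) by lra.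
have : (1 - eps) * mean J <= (1 - eps) * ((1 - eps) ^+ t * d + k).
  by rewrite ler_wpM2l // subr_ge0.
rewrite exprS; lra.
Qed.

End Contraction.

Unset Implicit Arguments.
Set Strict Implicit.

Theorem theorem1p3 (R : realType) (Omega : finType)
    (P : Omega -> Omega -> R) (hP : is_markov_chain P)
    (pi : Omega -> R) (hpi : is_unique_stationary P pi)
    (rho : Omega -> Omega -> int) (hrho : is_int_metric rho)
    (eps delta : R) (heps : 0 < eps) (heps1 : eps <= 1) (hdelta : 0 < delta)
    (S : {set Omega})
    (hS : forall x y, x \in S -> y \in S -> distance_decreasing P rho eps x y)
    (hpiS : prob pi S > 1 - eps * delta / (6 * (diam rho)%:~R))
    (T : nat) (hT : T%:R >= ln (2 * (diam rho)%:~R / delta) / eps)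
    (mu0 : Omega -> R) (hmu0 : warm_start pi mu0) :
  tv_dist (law_at P mu0 T) pi < delta.
Proof.
have [st _] := hpi; have pid := proj1 st.
set d : R := (diam rho)%:~R in hpiS hT.
set q := prob pi (~: S).
have q0 : 0 <= q by apply: sumr_ge0 => a _; rewrite (proj1 pid).
have hq : q < eps * delta / (6 * d) by rewrite /q prob_setC //; lra.
(* If [d = 0], division by zero turns [hq] into [q < 0]. *)
have d0 : 0 < d.
  rewrite lt_neqAle ler0z diam_ge0 andbT; apply/eqP => dz.
  by move: hq; rewrite -dz mulr0 invr0 mulr0 ltNge q0.
(* The fixed point of the recursion. The 6 in the bound on [pi] makes it less than half of [delta];
   the decay of the initial distance takes the other half. *)
pose k := 3 * d * q / eps.
have k0 : 0 <= k by rewrite /k divr_ge0 ?mulr_ge0 // ltW.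
have kd : k < delta / 2.
  rewrite /k ltr_pdivrMr //; move: hq; rewrite ltr_pdivlMr; last by lra.
  lra.
have hk : 3 * d * q <= eps * k by rewrite /k mulrCA divff ?mulr1 // gt_eqF.
have [J [hJ hJE]] :=
  warm_start_mean hP hrho heps1 hS T st hmu0 k0 hk.
apply: le_lt_trans (tv_dist_le_mean hrho hJ) _.
apply: le_lt_trans hJE _.
have decay : (1 - eps) ^+ T * d <= delta / 2.
  have r0 : 0 < 2 * d / delta by rewrite divr_gt0 // mulr_gt0.
  have : (1 - eps) ^+ T <= (2 * d / delta)^-1.
    (* Uses [1 - eps <= expR (- eps)]; then [hT] says exactly that [eps * T] is at least the
       logarithm of [2 * d / delta]. *)
    apply: (@le_trans _ _ (expR (- eps) ^+ T)).
      by apply: lerXn2r; rewrite ?nnegrE ?subr_ge0 ?expR_ge0 // expR_ge1Dx.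
    rewrite -expRM_natl -[X in _ <= X^-1](lnK r0) -expRN ler_expR.
    by move: hT; rewrite ler_pdivrMr // mulrN lerN2.
  rewrite -(ler_pM2r d0) invf_div => /le_trans; apply.
  rewrite le_eqVlt; apply/orP; left; apply/eqP; field.
  by rewrite gt_eqF.
by rewrite [ltRHS](splitr delta) ler_ltD.
Qed.
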